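(* Let $S:\mathbb{R}^n\times\mathbb{R}^m\to\mathbb{R}$ be convex-concave and continuously differentiable, with at least one saddle point, let $\rho>0$, and define $\hat S(x,\hat x,y,\hat y):=\frac{\rho}{2}\|x-\hat x\|^2+S(x,y)-\frac{\rho}{2}\|y-\hat y\|^2$ for $x,\hat x\in\mathbb{R}^n$, $y,\hat y\in\mathbb{R}^m$. Then the augmented saddle flow dynamics $$\dot x=-\nabla_xS(x,y)-\rho(x-\hat x),\quad \dot{\hat x}=\rho(x-\hat x),\quad \dot y=+\nabla_yS(x,y)-\rho(y-\hat y),\quad \dot{\hat y}=\rho(y-\hat y)$$ globally asymptotically converge to some saddle point $(x_\star,\hat x_\star,y_\star,\hat y_\star)$ of $\hat S$ (every trajectory from an arbitrary initial point converges as $t\to\infty$ to some saddle point of $\hat S$, possibly depending on the trajectory), with $(x_\star,y_\star)$ being a saddle point of $S$.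
   Context: $S$ is convex-concave if $S(\cdot,y)$ is convex for every $y$ and $S(x,\cdot)$ is concave for every $x$. A saddle point of $S$ is a point $(x_\star,y_\star)$ with $S(x_\star,y)\le S(x_\star,y_\star)\le S(x,y_\star)$ for all $x,y$. A saddle point of $\hat S$ is a point with $\hat S(x_\star,\hat x_\star,y,\hat y)\le\hat S(x_\star,\hat x_\star,y_\star,\hat y_\star)\le\hat S(x,\hat x,y_\star,\hat y_\star)$ for all $x,\hat x,y,\hat y$. *)

(* Defs.v *)
From HB Require Import structures.
From mathcomp Require Import all_boot all_order all_algebra.
From mathcomp Require Import all_classical all_reals all_analysis.
Set Implicit Arguments.
Unset Strict Implicit.
Unset Printing Implicit Defensive.
Import Order.TTheory GRing.Theory Num.Theory.
Import numFieldNormedType.Exports.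
Local Open Scope classical_set_scope.
Local Open Scope ring_scope.

(* The library norm on 'rV[R]_n is the sup norm; the quadratic terms of the
   augmented function need the Euclidean one. *)
Definition sqnorm2 (R : realType) (n : nat) (v : 'rV[R]_n) : R :=
  \sum_(i < n) v ord0 i ^+ 2.

Definition gradient (R : realType) (n : nat) (f : 'rV[R]_n -> R)
    (a : 'rV[R]_n) : 'rV[R]_n :=
  \row_(i < n) 'D_('e_i) (f : 'rV[R]_n -> R^o) a.

Definition convex_concave (R : realType) (n m : nat)
    (S : 'rV[R]_n -> 'rV[R]_m -> R) : Prop :=
  (forall y, convex_function setT (fun x => S x y)) /\
  (forall x, convex_function setT (fun y => - S x y)).

(* In finite dimension, continuity of the Frechet derivative in operator norm
   amounts to continuity of its value on each fixed direction v. *)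
Definition continuously_differentiable (R : realType) (V : normedModType R)
    (f : V -> R) : Prop :=
  (forall a, differentiable (f : V -> R^o) a) /\
  (forall v, continuous (fun a => 'd (f : V -> R^o) a v)).

Definition saddle_point (R : realType) (X Y : Type) (F : X -> Y -> R)
    (xs : X) (ys : Y) : Prop :=
  forall x y, F xs y <= F xs ys /\ F xs ys <= F x ys.

(* The minimized variables (x, xh) and the maximized variables (y, yh) are
   paired, so that saddle_point applies to the augmented function. *)
Definition augmented (R : realType) (n m : nat)
    (S : 'rV[R]_n -> 'rV[R]_m -> R) (rho : R)
    (p : 'rV[R]_n * 'rV[R]_n) (q : 'rV[R]_m * 'rV[R]_m) : R :=
  rho / 2 * sqnorm2 (p.1 - p.2) + S p.1 q.1 - rho / 2 * sqnorm2 (q.1 - q.2).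

(* Solutions on [0, +oo[ of the differential equation.  At t = 0 only
   continuity is asked: the one-sided derivative at 0 then exists and satisfies
   the equation, because the right-hand side is continuous. *)
Definition augmented_saddle_flow (R : realType) (n m : nat)
    (S : 'rV[R]_n -> 'rV[R]_m -> R) (rho : R)
    (x xh : R -> 'rV[R]_n) (y yh : R -> 'rV[R]_m) : Prop :=
  [/\ {within `[0, +oo[, continuous x}, {within `[0, +oo[, continuous xh},
      {within `[0, +oo[, continuous y} & {within `[0, +oo[, continuous yh}] /\
  forall t : R, 0 < t ->
    [/\ is_derive t 1 x
          (- gradient (fun u => S u (y t)) (x t) - rho *: (x t - xh t)),
        is_derive t 1 xh (rho *: (x t - xh t)),
        is_derive t 1 y
          (gradient (fun v => S (x t) v) (y t) - rho *: (y t - yh t)) &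
        is_derive t 1 yh (rho *: (y t - yh t))].

(* Main.v *)
(* The squared distance to (a, a, b, b), where (a, b) is a saddle point of
   S, is a Lyapunov function: by convexity-concavity it decreases at rate at
   least 2 rho (|x - xh|^2 + |y - yh|^2). Hence trajectories are bounded and
   Lipschitz. In place of LaSalle's principle, a quantity that is Cauchy
   along a Lipschitz trajectory has zero rate at every cluster point.
   Applied to the Lyapunov function, this gives x = xh and y = yh at cluster
   points, so that x - xh and y - yh tend to 0; applied to the coordinates
   of these differences, it makes the gradients of S vanish at cluster
   points, which are thus saddle points. The Lyapunov function relative to a
   cluster point is nonincreasing and gets arbitrarily small, so the
   trajectory converges. *)

Require Import Defs.
From HB Require Import structures.
From mathcomp Require Import all_boot all_order all_algebra.
From mathcomp Require Import all_classical all_reals all_analysis.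
From mathcomp Require Import lra ring.
Set Implicit Arguments.
Unset Strict Implicit.
Unset Printing Implicit Defensive.
Import Order.TTheory GRing.Theory Num.Theory.
Import numFieldNormedType.Exports.
Local Open Scope classical_set_scope.
Local Open Scope ring_scope.

(** * Rates of change and cluster points of functions of positive time *)

Lemma increment_derive (R : realType) (f df : R -> R) (a b : R) :
  (forall t : R, 0 < t -> is_derive t 1 f (df t)) -> 0 < a -> a < b ->
  exists2 c, a < c < b & f b - f a = df c * (b - a).
Proof.
move=> fdf a0 ab.
have [||c + fab] := @MVT R f df a b ab.
- move=> t; rewrite in_itv/= => /andP[ac _].
  by apply: fdf; apply: lt_trans ac.
- apply: derivable_within_continuous => t; rewrite in_itv/= => /andP[at_ _].
  by have := fdf t (lt_le_trans a0 at_); case.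
- by rewrite in_itv/= => acb; exists c.
Qed.

Lemma nonincreasing_of_derive (R : realType) (f df : R -> R) :
  (forall t : R, 0 < t -> is_derive t 1 f (df t)) ->
  (forall t : R, 0 < t -> df t <= 0) ->
  forall s t : R, 0 < s -> s <= t -> f t <= f s.
Proof.
move=> fdf df0 s t s0; rewrite le_eqVlt => /predU1P[->//|st].
have [c /andP[sc _] e] := increment_derive fdf s0 st.
rewrite -subr_le0 e; apply: mulr_le0_ge0; last by rewrite subr_ge0 ltW.
by apply: df0; apply: lt_trans sc.
Qed.

(** Once [f] comes within [e] of its infimum over positive times, monotonicity keeps all later
    values between that infimum and this value. *)
Lemma nonincreasing_cauchy (R : realType) (f : R -> R) :
  (forall s t : R, 0 < s -> s <= t -> f t <= f s) -> (forall t, 0 <= f t) ->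
  forall e : R, 0 < e ->
  exists T : R, forall s t, T <= s -> T <= t -> `|f t - f s| < e.
Proof.
move=> fni f0 e e0; pose A := f @` [set t | 0 < t].
have infA : has_inf A.
  split; first by exists (f 1); exists 1 => //=.
  by exists 0 => _ [t _ <-].
have [_ [T /= T0 <-] fT] := inf_adherent e0 infA.
exists T => s t Ts Tt.
have lb u : T <= u -> inf A <= f u <= f T.
  move=> Tu; rewrite fni// andbT ge_inf//; first exact: infA.2.
  by exists u => //=; exact: lt_le_trans Tu.
have /andP[s1 s2] := lb _ Ts; have /andP[t1 t2] := lb _ Tt.
rewrite ltr_distl; apply/andP; split; lra.
Qed.

Lemma cauchy_of_cvg (R : realType) (f : R -> R) (l : R) :
  f t @[t --> +oo] --> l ->
  forall e : R, 0 < e ->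
  exists T : R, forall s t, T <= s -> T <= t -> `|f t - f s| < e.
Proof.
move=> /cvgrPdist_lt fl e e0; have [|T [_ fT]] := fl (e / 2).
  by rewrite divr_gt0.
exists (T + 1) => s t Ts Tt.
have fs : `|l - f s| < e / 2 by apply: fT; lra.
have ft : `|l - f t| < e / 2 by apply: fT; lra.
have := ler_distD l (f t) (f s); rewrite [`|f t - l|]distrC.
by lra.
Qed.

(* If [g p] were positive, the Lipschitz bound would keep the trajectory near
   [p] for a fixed duration after each visit, so that [phi] would gain a fixed
   amount infinitely often. *)
Lemma cluster_rate_le0 (R : realType) (T : normedModType R) (z : R -> T)
    (phi : R -> R) (g : T -> R) (L : R) (p : T) :
  (forall s t : R, 1 <= s -> s <= t -> `|z t - z s| <= L * (t - s)) ->
  (forall t : R, 0 < t -> is_derive t 1 phi (g (z t))) ->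
  (forall e : R, 0 < e ->
    exists T : R, forall s t, T <= s -> T <= t -> `|phi t - phi s| < e) ->
  {for p, continuous g} -> cluster (z @ +oo) p -> g p <= 0.
Proof.
move=> zL dphi cphi gp clp; rewrite leNgt; apply/negP => gp0.
have : \forall q \near p, g p / 2 < g q.
  by apply: (cvgr_gt (g p)) => //; lra.
move=> /nbhs_ballP[r /= r0 rg].
(* Adding 1 keeps the speed bound positive whatever [L] is. In a time [tau] the trajectory moves at
   most [M * tau = r / 2], so it stays in [ball p r] if it starts in [ball p (r / 2)]. *)
pose M := `|L| + 1; have M0 : 0 < M by rewrite /M ltr_wpDl.
pose tau := r / (2 * M).
have tau0 : 0 < tau by rewrite divr_gt0 ?mulr_gt0.
have Mtau : M * tau = r / 2 by rewrite /tau; field; rewrite gt_eqF.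
(* The tolerance is the least gain of [phi] over a duration [tau] during which the rate exceeds
   [g p / 2]. *)
have [|T0 cT0] := cphi (g p / 2 * tau).
  by apply: mulr_gt0 => //; rewrite divr_gt0.
have [_ [[s [s1 sT] <-] sr]] :
    exists q, (z @` [set s | 1 <= s /\ T0 <= s]) q /\ ball p (r / 2) q.
  apply: clp; last by apply: nbhsx_ballx; rewrite divr_gt0.
  have : \forall s \near +oo, 1 <= s /\ T0 <= s.
    by apply: filterI; apply: nbhs_pinfty_ge; rewrite num_real.
  by apply: filterS => s; exists s.
have s0 : 0 < s by lra.
have sst : s < s + tau by rewrite ltrDl.
have [c /andP[sc ct] e] := increment_derive dphi s0 sst.
have pc : ball p r (z c).
  rewrite [r]splitr; apply: (ball_triangle sr).
  rewrite -ball_normE/= distrC; apply: le_lt_trans (zL _ _ s1 (ltW sc)) _.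
  rewrite -Mtau; apply: (@le_lt_trans _ _ (`|L| * (c - s))).
    by rewrite ler_wpM2r ?ler_norm// subr_ge0 ltW.
  apply: (@lt_le_trans _ _ (M * (c - s))).
    by rewrite ltr_pM2r ?subr_gt0 ?ltrDl.
  by rewrite ler_pM2l//; lra.
have := cT0 s (s + tau) sT (le_trans sT (ltW sst)).
rewrite e addrAC subrr add0r ltr_norml => /andP[_].
by rewrite ltr_pM2r// ltNge ltW// rg.
Qed.

(** The one-sided bound applies to [phi] with rate [g] and to [- phi] with rate [- g]. *)
Lemma cluster_rate_eq0 (R : realType) (T : normedModType R) (z : R -> T)
    (phi : R -> R) (g : T -> R) (L : R) (p : T) :
  (forall s t : R, 1 <= s -> s <= t -> `|z t - z s| <= L * (t - s)) ->
  (forall t : R, 0 < t -> is_derive t 1 phi (g (z t))) ->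
  (forall e : R, 0 < e ->
    exists T : R, forall s t, T <= s -> T <= t -> `|phi t - phi s| < e) ->
  {for p, continuous g} -> cluster (z @ +oo) p -> g p = 0.
Proof.
move=> zL dphi cphi gp clp; apply/le_anti.
rewrite (cluster_rate_le0 zL dphi cphi gp clp) -oppr_le0.
apply: (@cluster_rate_le0 _ _ z (- phi) (- g) L) => //.
- by move=> t t0; apply: is_deriveN; exact: dphi.
- move=> e /cphi[T0 cT0]; exists T0 => s t Ts Tt.
  by rewrite -opprD normrN cT0.
- exact: cvgN.
Qed.

(** If [h (z t)] stayed away from [c] at arbitrarily large times, compactness would give a cluster
    point of [z] along those times, where [h] would both equal [c] and be at distance at least [e]
    from it. *)
Lemma cvg_of_cluster (R : realType) (T : topologicalType) (z : R -> T)
    (K : set T) (h : T -> R) (c : R) :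
  compact K -> (\forall t \near +oo, K (z t)) -> continuous h ->
  (forall p, cluster (z @ +oo) p -> h p = c) ->
  h (z t) @[t --> +oo] --> c.
Proof.
move=> cK zK ch hc; apply/cvgrPdist_lt => e e0; apply: contrapT => nB.
pose B := [set t | ~ `|c - h (z t)| < e].
(* The bad times [B] meet every neighbourhood of [+oo]: otherwise [h (z t)] would eventually lie
   within [e] of [c]. *)
have PG : ProperFilter (within B +oo).
  apply: Build_ProperFilter_ex => P wP; apply: contrapT => nP.
  have {}wP : \forall t \near +oo, B t -> P t := wP.
  apply: nB; near=> t; have Pt : B t -> P t by near: t.
  by apply: contrapT => Bt; apply: nP; exists t; exact: Pt.
have wK : (z @ within B +oo) K by apply: (@filterS R +oo) zK => t Kt _.
have [p [Kp clp]] := cK (z @ within B +oo) _ wK.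
have hp : h p = c.
  (* Restricting to [B] refines the filter, so a cluster point along [B] is also one of
     [z @ +oo]. *)
  by apply: hc; apply: cvg_cluster clp => P; apply: (@filterS R +oo) => t Pt _.
have [_ [[t Bt <-]]] : (z @` B) `&` [set q | `|c - h q| < e] !=set0.
  apply: clp.
    by apply: (@filterE _ +oo) => t Bt; exists t.
  by rewrite /= -hp; have /cvgrPdist_lt := ch p; exact.
by [].
Unshelve. all: by end_near. Qed.

(** * Euclidean inner product and squared norm of row vectors *)

Definition dotv (R : realType) (n : nat) (u v : 'rV[R]_n) : R :=
  \sum_(i < n) u ord0 i * v ord0 i.

Lemma dotvDr (R : realType) (n : nat) (u v w : 'rV[R]_n) :
  dotv u (v + w) = dotv u v + dotv u w.
Proof. by rewrite -big_split; apply: eq_bigr => i _; rewrite mxE mulrDr. Qed.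

Lemma dotvZr (R : realType) (n : nat) (u v : 'rV[R]_n) k :
  dotv u (k *: v) = k * dotv u v.
Proof. by rewrite mulr_sumr; apply: eq_bigr => i _; rewrite mxE mulrCA. Qed.

Lemma dotvNr (R : realType) (n : nat) (u v : 'rV[R]_n) :
  dotv u (- v) = - dotv u v.
Proof. by rewrite -scaleN1r dotvZr mulN1r. Qed.

Lemma dotvBl (R : realType) (n : nat) (u v w : 'rV[R]_n) :
  dotv (u - v) w = dotv u w - dotv v w.
Proof. by rewrite -sumrB; apply: eq_bigr => i _; rewrite !mxE mulrBl. Qed.

Lemma dotvv (R : realType) (n : nat) (u : 'rV[R]_n) : dotv u u = sqnorm2 u.
Proof. by apply: eq_bigr => i _; rewrite expr2. Qed.

Lemma sqnorm2_0 (R : realType) (n : nat) : sqnorm2 (0 : 'rV[R]_n) = 0.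
Proof. by apply: big1 => i _; rewrite mxE expr0n. Qed.

Lemma sqnorm2_ge0 (R : realType) (n : nat) (u : 'rV[R]_n) : 0 <= sqnorm2 u.
Proof. by apply: sumr_ge0 => i _; exact: sqr_ge0. Qed.

Lemma sqnorm2_coord (R : realType) (n : nat) (u : 'rV[R]_n) i :
  u ord0 i ^+ 2 <= sqnorm2 u.
Proof.
by rewrite /sqnorm2 (bigD1 i)//= lerDl sumr_ge0// => j _; exact: sqr_ge0.
Qed.

Lemma sqnorm2_eq0 (R : realType) (n : nat) (u : 'rV[R]_n) :
  sqnorm2 u <= 0 -> u = 0.
Proof.
move=> u0; apply/rowP => i; rewrite mxE; apply/eqP.
by rewrite -sqrf_eq0 eq_le sqr_ge0 andbT (le_trans (sqnorm2_coord u i)).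
Qed.

(** * Directional derivatives and the tangent inequality *)

Lemma dotv_gradient (R : realType) (n : nat) (f : 'rV[R]_n -> R) a v :
  differentiable (f : 'rV[R]_n -> R^o) a ->
  dotv v (gradient f a) = 'D_v (f : 'rV[R]_n -> R^o) a.
Proof.
move=> df; rewrite deriveE// [in RHS](row_sum_delta v) linear_sum.
by apply: eq_bigr => i _; rewrite linearZ mxE deriveE.
Qed.

(** Convexity bounds the difference quotient in the direction [b - a] by [f b - f a] for steps [h]
    in []0, 1]]; the inequality follows as [h] decreases to 0. *)
Lemma convex_ge_tangent (R : realType) (V : normedModType R) (f : V -> R)
    (a b : V) :
  convex_function setT f -> differentiable (f : V -> R^o) a ->
  f a + 'D_(b - a) (f : V -> R^o) a <= f b.
Proof.
move=> cf df; rewrite -lerBrDl.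
have dfc : h^-1 *: ((f \o shift a) (h *: (b - a)) - f a) @[h --> 0^'+] -->
    'D_(b - a) (f : V -> R^o) a.
  apply: cvg_dnbhs_at_right.
  by have := @diff_derivable _ _ _ (f : V -> R^o) a (b - a) df.
apply: cvgr_to_le dfc _; near=> h.
have h0 : 0 < h by near: h; exact: nbhs_right_gt.
have h1 : h <= 1 by apply: ltW; near: h; exact: nbhs_right_lt.
have cfh : f (h *: b + (1 - h) *: a) <= h * f b + (1 - h) * f a.
  exact: cf (Itv01 (ltW h0) h1) b a (in_setT _) (in_setT _).
rewrite /= ler_pdivrMl// [h *: (b - a) + a](_ : _ = h *: b + (1 - h) *: a).
  lra.
by rewrite scalerBr scalerBl scale1r addrAC addrA.
Unshelve. all: by end_near. Qed.

(** Both sides are limits of the same difference quotient. This carries the smoothness hypothesis,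
    stated for the joint function, over to the partial gradients. *)
Lemma derive_pair1 (R : realType) (U V : normedModType R) (f : U * V -> R)
    x y v :
  'D_v ((fun u => f (u, y)) : U -> R^o) x = 'D_(v, 0) (f : U * V -> R^o) (x, y).
Proof.
rewrite /derive [X in _ = lim (X @ _)](_ : _ =
  fun h : R => h^-1 *: (f (h *: v + x, y) - f (x, y)))//.
apply: funext => h /=; congr (_ *: (f _ - _)).
by congr pair; rewrite /= scaler0 add0r.
Qed.

Lemma derive_pair2 (R : realType) (U V : normedModType R) (f : U * V -> R)
    x y v :
  'D_v ((fun u => f (x, u)) : V -> R^o) y = 'D_(0, v) (f : U * V -> R^o) (x, y).
Proof.
rewrite /derive [X in _ = lim (X @ _)](_ : _ =
  fun h : R => h^-1 *: (f (x, h *: v + y) - f (x, y)))//.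
apply: funext => h /=; congr (_ *: (f _ - _)).
by congr pair; rewrite /= scaler0 add0r.
Qed.

(** * Derivatives of curves, compactness and Lipschitz bounds *)

Lemma is_derive_coord (R : realType) (n : nat) (x : R -> 'rV[R]_n) dx
    (t : R) i :
  is_derive t 1 x dx -> is_derive t 1 (fun s => x s ord0 i) (dx ord0 i).
Proof.
move=> [dxt <-]; split; first exact: (derivable_mxP _ _ _).1 dxt ord0 i.
by rewrite derive_mx// mxE.
Qed.

Lemma is_derive_sqnorm2 (R : realType) (n : nat) (x : R -> 'rV[R]_n) dx
    a (t : R) :
  is_derive t 1 x dx ->
  is_derive t 1 (fun s => sqnorm2 (x s - a)) (2 * dotv (x t - a) dx).
Proof.
move=> xdx.
have -> : (fun s => sqnorm2 (x s - a)) =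
    \sum_(i < n) ((fun s => x s ord0 i) - cst (a ord0 i)) ^+ 2.
  apply/funext => s; rewrite fct_sumE; apply: eq_bigr => i _.
  by rewrite !mxE.
rewrite mulr_sumr; apply: is_derive_sum => i.
have := is_derive_coord i xdx => ?.
apply: is_derive_eq.
by rewrite subr0 expr1 mulrA !mxE.
Qed.

Lemma rV_norm_le (R : realType) (n : nat) (u : 'rV[R]_n) (M : R) :
  0 <= M -> (forall i, `|u ord0 i| <= M) -> `|u| <= M.
Proof.
move=> M0 uM; rewrite [leLHS]/Num.Def.normr/= mx_normrE; apply: bigmax_le => //.
by move=> [i j] _; rewrite (ord1 i).
Qed.

Lemma compact_box (R : realType) (n : nat) (a : 'rV[R]_n) (r : R) :
  compact [set u : 'rV[R]_n | forall i, `|u ord0 i - a ord0 i| <= r].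
Proof.
have := @rV_compact R n (fun i => `[a ord0 i - r, a ord0 i + r]%classic)
  (fun i => @segment_compact R _ _).
congr compact; apply: eq_set => u; apply: eq_forall => i.
by rewrite /= in_itv/= ler_distl.
Qed.

Lemma compact_continuous_bound (R : realType) (T : topologicalType) (K : set T)
    (h : T -> R) :
  compact K -> continuous h ->
  exists2 M, 0 <= M & forall q, K q -> `|h q| <= M.
Proof.
move=> cK ch.
have /compact_bounded[M [_ hM]] : compact (h @` K).
  by apply: continuous_compact => //; exact: continuous_subspaceT.
exists (`|M| + 1) => [|q Kq]; first by rewrite addr_ge0.
by apply: (hM (`|M| + 1)); [rewrite ltr_pwDr// ler_norm|exists q].
Qed.

(** The mean value theorem holds only for real values, so it is applied to each coordinate, whose
    speed is bounded because [F] is continuous on the compact [K]. *)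
Lemma lipschitz_trajectory (R : realType) (T : topologicalType) (n : nat)
    (z : R -> T) (K : set T) (F : T -> 'rV[R]_n) (x : R -> 'rV[R]_n) :
  compact K -> (forall t, 1 <= t -> K (z t)) ->
  (forall i, continuous (fun q => F q ord0 i)) ->
  (forall t : R, 0 < t -> is_derive t 1 x (F (z t))) ->
  exists2 L, 0 <= L &
    forall s t : R, 1 <= s -> s <= t -> `|x t - x s| <= L * (t - s).
Proof.
move=> cK zK cF dx.
have /choice[M MP] i : exists M, 0 <= M /\ forall q, K q -> `|F q ord0 i| <= M.
  by have [M ? ?] := compact_continuous_bound cK (cF i); exists M.
have M0 i : 0 <= M i by case: (MP i).
(* The sum of the nonnegative coordinate bounds dominates each of them. *)
exists (\sum_i M i) => [|s t s1]; first exact: sumr_ge0.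
rewrite le_eqVlt => /predU1P[->|st].
  by rewrite !subrr normr0 mulr0.
have s0 : 0 < s by apply: lt_le_trans s1.
apply: rV_norm_le => [|i].
  by rewrite mulr_ge0 ?sumr_ge0// subr_ge0 ltW.
have [c /andP[sc _] e] := increment_derive
  (fun u u0 => is_derive_coord i (dx u u0)) s0 st.
rewrite !mxE e normrM (gtr0_norm (_ : 0 < t - s)) ?subr_gt0//.
rewrite ler_pM2r ?subr_gt0// (bigD1 i)//=.
apply: ler_wpDr; first by apply: sumr_ge0.
by apply: (MP i).2; apply: zK; apply: le_trans (ltW sc).
Qed.

Lemma continuous_coord (R : realType) (T : topologicalType) (k : nat)
    (u : T -> 'rV[R]_k) i :
  continuous u -> continuous (fun q => u q ord0 i).
Proof.
move=> cu q; apply: (@continuous_comp _ _ _ u (fun v : 'rV[R]_k => v ord0 i)).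
  exact: cu.
exact: coord_continuous.
Qed.

Lemma continuous_dotv (R : realType) (T : topologicalType) (n : nat)
    (u v : T -> 'rV[R]_n) :
  (forall i, continuous (fun q => u q ord0 i)) ->
  (forall i, continuous (fun q => v q ord0 i)) ->
  continuous (fun q => dotv (u q) (v q)).
Proof.
move=> cu cv; apply: continuous_big => [|i _ q]; first exact: add_continuous.
by apply: cvgM; [exact: cu|exact: cv].
Qed.

(** * First-order inequalities for convex functions *)

Lemma gradientN (R : realType) (n : nat) (f : 'rV[R]_n -> R) a :
  differentiable (f : 'rV[R]_n -> R^o) a ->
  gradient (fun u => - f u) a = - gradient f a.
Proof.
move=> df; apply/rowP => i; rewrite !mxE.
by rewrite (@deriveN _ _ _ (f : 'rV[R]_n -> R^o))//; exact: diff_derivable.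
Qed.

(** The tangent inequality at [x], evaluated at [a]. The left side is half the rate of the squared
    distance to [a] under the motion along minus the gradient. *)
Lemma convex_descent (R : realType) (n : nat) (f : 'rV[R]_n -> R) x a :
  convex_function setT f -> differentiable (f : 'rV[R]_n -> R^o) x ->
  dotv (x - a) (- gradient f x) <= f a - f x.
Proof.
move=> cf df; have := convex_ge_tangent a cf df.
by rewrite -dotv_gradient// !dotvBl !dotvNr; lra.
Qed.

Lemma convex_gradient0_min (R : realType) (n : nat) (f : 'rV[R]_n -> R) x a :
  convex_function setT f -> differentiable (f : 'rV[R]_n -> R^o) x ->
  gradient f x = 0 -> f x <= f a.
Proof.
move=> cf df g0; have := convex_descent a cf df; rewrite g0 oppr0.
have -> : dotv (x - a) 0 = 0 by apply: big1 => i _; rewrite !mxE mulr0.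
by rewrite subr_ge0.
Qed.

(** * Differentiability in each variable and continuity of the partial gradients *)

Section partials.
Context (R : realType) (n m : nat) (S : 'rV[R]_n -> 'rV[R]_m -> R).
Hypothesis S_C1 : continuously_differentiable
  (fun z : 'rV[R]_n * 'rV[R]_m => S z.1 z.2).

Lemma differentiable_partial1 x y :
  differentiable ((fun u => S u y) : 'rV[R]_n -> R^o) x.
Proof.
apply: (@differentiable_comp _ _ _ _ (fun u => (u, y))
  ((fun z : 'rV[R]_n * 'rV[R]_m => S z.1 z.2) : _ -> R^o)).
  by apply: differentiable_pair => //; exact: differentiable_cst.
exact: S_C1.1.
Qed.

Lemma differentiable_partial2 x y :
  differentiable ((fun v => S x v) : 'rV[R]_m -> R^o) y.
Proof.
apply: (@differentiable_comp _ _ _ _ (fun v => (x, v))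
  ((fun z : 'rV[R]_n * 'rV[R]_m => S z.1 z.2) : _ -> R^o)).
  by apply: differentiable_pair => //; exact: differentiable_cst.
exact: S_C1.1.
Qed.

(** Each coordinate is the joint differential in the fixed direction [('e_i, 0)], which depends
    continuously on the base point by [S_C1]. *)
Lemma continuous_gradient1 (T : topologicalType) (x : T -> 'rV[R]_n)
    (y : T -> 'rV[R]_m) i :
  continuous x -> continuous y ->
  continuous (fun q => gradient (fun u => S u (y q)) (x q) ord0 i).
Proof.
move=> cx cy.
rewrite [X in continuous X](_ : _ = (fun z => 'd
  ((fun z : 'rV[R]_n * 'rV[R]_m => S z.1 z.2) : _ -> R^o) z ('e_i, 0))
  \o (fun q => (x q, y q))).
  move=> q; apply: continuous_comp; last exact: S_C1.2.
  exact: cvg_pair (cx q) (cy q).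
apply: funext => q /=; rewrite mxE.
rewrite (derive_pair1 (fun z : 'rV[R]_n * 'rV[R]_m => S z.1 z.2)) deriveE//.
exact: S_C1.1.
Qed.

Lemma continuous_gradient2 (T : topologicalType) (x : T -> 'rV[R]_n)
    (y : T -> 'rV[R]_m) i :
  continuous x -> continuous y ->
  continuous (fun q => gradient (fun v => S (x q) v) (y q) ord0 i).
Proof.
move=> cx cy.
rewrite [X in continuous X](_ : _ = (fun z => 'd
  ((fun z : 'rV[R]_n * 'rV[R]_m => S z.1 z.2) : _ -> R^o) z (0, 'e_i))
  \o (fun q => (x q, y q))).
  move=> q; apply: continuous_comp; last exact: S_C1.2.
  exact: cvg_pair (cx q) (cy q).
apply: funext => q /=; rewrite mxE.
rewrite (derive_pair2 (fun z : 'rV[R]_n * 'rV[R]_m => S z.1 z.2)) deriveE//.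
exact: S_C1.1.
Qed.

End partials.

(* A state is ((x, xh), (y, yh)), paired as in [augmented]. *)
Local Notation state R n m :=
  (('rV[R]_n * 'rV[R]_n) * ('rV[R]_m * 'rV[R]_m))%type.

Lemma continuous_11 (R : realType) (n m : nat) :
  continuous (fun q : state R n m => q.1.1).
Proof. by move=> q; apply: cvg_comp; exact: cvg_fst. Qed.

Lemma continuous_12 (R : realType) (n m : nat) :
  continuous (fun q : state R n m => q.1.2).
Proof. by move=> q; apply: cvg_comp; [exact: cvg_fst|exact: cvg_snd]. Qed.

Lemma continuous_21 (R : realType) (n m : nat) :
  continuous (fun q : state R n m => q.2.1).
Proof. by move=> q; apply: cvg_comp; [exact: cvg_snd|exact: cvg_fst]. Qed.

Lemma continuous_22 (R : realType) (n m : nat) :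
  continuous (fun q : state R n m => q.2.2).
Proof. by move=> q; apply: cvg_comp; exact: cvg_snd. Qed.

(** * The vector field of the flow and the dissipation of the Lyapunov function *)

Section augmented_field.
Context (R : realType) (n m : nat) (S : 'rV[R]_n -> 'rV[R]_m -> R) (rho : R).

Definition velocity_x (q : state R n m) : 'rV[R]_n :=
  - gradient (fun u => S u q.2.1) q.1.1 - rho *: (q.1.1 - q.1.2).

Definition velocity_xh (q : state R n m) : 'rV[R]_n :=
  rho *: (q.1.1 - q.1.2).

Definition velocity_y (q : state R n m) : 'rV[R]_m :=
  gradient (fun v => S q.1.1 v) q.2.1 - rho *: (q.2.1 - q.2.2).

Definition velocity_yh (q : state R n m) : 'rV[R]_m :=
  rho *: (q.2.1 - q.2.2).

Definition lyapunov (a : 'rV[R]_n) (b : 'rV[R]_m) (q : state R n m) : R :=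
  (sqnorm2 (q.1.1 - a) + sqnorm2 (q.1.2 - a)) +
  (sqnorm2 (q.2.1 - b) + sqnorm2 (q.2.2 - b)).

(** The derivative of [lyapunov a b] along the vector field, taken as a function of the state so
    that it can be evaluated at cluster points as well as on trajectories. *)
Definition lyapunov_rate (a : 'rV[R]_n) (b : 'rV[R]_m) (q : state R n m) : R :=
  (2 * dotv (q.1.1 - a) (velocity_x q) + 2 * dotv (q.1.2 - a) (velocity_xh q)) +
  (2 * dotv (q.2.1 - b) (velocity_y q) + 2 * dotv (q.2.2 - b) (velocity_yh q)).

Lemma lyapunov_ge0 a b q : 0 <= lyapunov a b q.
Proof. by rewrite !addr_ge0// sqnorm2_ge0. Qed.

Hypothesis S_cc : convex_concave S.
Hypothesis S_C1 : continuously_differentiable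
  (fun z : 'rV[R]_n * 'rV[R]_m => S z.1 z.2).

(** The gradient terms contribute at most twice [(S a y - S x y) + (S x y - S x b) = S a y - S x b],
    which is nonpositive at a saddle point. The coupling terms add up exactly to the right-hand
    side. *)
Lemma lyapunov_dissipation a b q : saddle_point S a b ->
  lyapunov_rate a b q <=
    - (2 * rho) * (sqnorm2 (q.1.1 - q.1.2) + sqnorm2 (q.2.1 - q.2.2)).
Proof.
case: q => -[x xh] [y yh] sab; rewrite /lyapunov_rate/=.
have cx := convex_descent a (S_cc.1 y) (differentiable_partial1 S_C1 x y).
have dN : differentiable ((fun v => - S x v) : 'rV[R]_m -> R^o) y.
  exact/differentiableN/differentiable_partial2.
have := convex_descent b (S_cc.2 x) dN.
rewrite (gradientN (differentiable_partial2 S_C1 x y)) opprK => cy.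
have [sb _] := sab x y; have [_ sa] := sab x y.
have wx : dotv (x - a) (x - xh) - dotv (xh - a) (x - xh) = sqnorm2 (x - xh).
  by rewrite -dotvBl opprB addrA subrK dotvv.
have wy : dotv (y - b) (y - yh) - dotv (yh - b) (y - yh) = sqnorm2 (y - yh).
  by rewrite -dotvBl opprB addrA subrK dotvv.
rewrite /velocity_x /velocity_xh /velocity_y /velocity_yh/=.
rewrite !dotvDr !dotvNr !dotvZr -wx -wy in cx *.
by lra.
Qed.

(** By convexity, a zero of each partial gradient is a global minimum of [S] in the first variable
    and of [- S] in the second. *)
Lemma saddle_point_of_gradient0 x y :
  gradient (fun u => S u y) x = 0 -> gradient (fun v => S x v) y = 0 ->
  saddle_point S x y.
Proof.
move=> gx gy u v; split.
  have dN : differentiable ((fun v => - S x v) : 'rV[R]_m -> R^o) y.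
    exact/differentiableN/differentiable_partial2.
  rewrite -lerN2; apply: (@convex_gradient0_min _ _ (fun v => - S x v)) => //.
    exact: S_cc.2.
  by rewrite (gradientN (differentiable_partial2 S_C1 x y)) gy oppr0.
apply: (@convex_gradient0_min _ _ (fun u => S u y)) => //.
  exact: S_cc.1.
exact: differentiable_partial1.
Qed.

Lemma continuous_velocity_xh i :
  continuous (fun q => velocity_xh q ord0 i).
Proof.
apply: continuous_coord => q; apply: cvgZr.
by apply: cvgB; [exact: (@continuous_11 R n m)|exact: (@continuous_12 R n m)].
Qed.

Lemma continuous_velocity_yh i :
  continuous (fun q => velocity_yh q ord0 i).
Proof.
apply: continuous_coord => q; apply: cvgZr.
by apply: cvgB; [exact: (@continuous_21 R n m)|exact: (@continuous_22 R n m)].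
Qed.

Lemma continuous_velocity_x i :
  continuous (fun q => velocity_x q ord0 i).
Proof.
rewrite [X in continuous X](_ : _ = fun q =>
    - gradient (fun u => S u q.2.1) q.1.1 ord0 i - velocity_xh q ord0 i).
  move=> q; apply: cvgB; last exact: continuous_velocity_xh.
  apply: cvgN.
  exact: (continuous_gradient1 S_C1
    (@continuous_11 R n m) (@continuous_21 R n m)).
by apply: funext => q'; rewrite !mxE.
Qed.

Lemma continuous_velocity_y i :
  continuous (fun q => velocity_y q ord0 i).
Proof.
rewrite [X in continuous X](_ : _ = fun q =>
    gradient (fun v => S q.1.1 v) q.2.1 ord0 i - velocity_yh q ord0 i).
  move=> q; apply: cvgB; last exact: continuous_velocity_yh.
  exact: (continuous_gradient2 S_C1
    (@continuous_11 R n m) (@continuous_21 R n m)).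
by apply: funext => q'; rewrite !mxE.
Qed.

Lemma continuous_lyapunov a b : continuous (lyapunov a b).
Proof.
have sub k (u : state R n m -> 'rV[R]_k) c : continuous u ->
    continuous (fun q => sqnorm2 (u q - c)).
  move=> cu; under eq_fun do rewrite -dotvv.
  by apply: continuous_dotv => i; apply: continuous_coord => q;
    apply: cvgB (cu q) (cvg_cst _).
move=> q; apply: cvgD; apply: cvgD; apply: sub.
- exact: (@continuous_11 R n m).
- exact: (@continuous_12 R n m).
- exact: (@continuous_21 R n m).
- exact: (@continuous_22 R n m).
Qed.

Lemma continuous_lyapunov_rate a b : continuous (lyapunov_rate a b).
Proof.
have sub k (u v : state R n m -> 'rV[R]_k) c : continuous u ->
    (forall i, continuous (fun q => v q ord0 i)) ->
    continuous (fun q => 2 * dotv (u q - c) (v q)).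
  move=> cu cv q; apply: cvgM; first exact: cvg_cst.
  have cd : continuous (fun q => dotv (u q - c) (v q)).
    apply: continuous_dotv => // i.
    by apply: continuous_coord => {}q; apply: cvgB (cu q) (cvg_cst _).
  exact: cd.
move=> q; apply: cvgD; apply: cvgD; apply: sub.
- exact: (@continuous_11 R n m).
- exact: continuous_velocity_x.
- exact: (@continuous_12 R n m).
- exact: continuous_velocity_xh.
- exact: (@continuous_21 R n m).
- exact: continuous_velocity_y.
- exact: (@continuous_22 R n m).
- exact: continuous_velocity_yh.
Qed.
End augmented_field.

(** * Boundedness, cluster points and convergence of a trajectory *)

Section trajectory.
Context (R : realType) (n m : nat) (S : 'rV[R]_n -> 'rV[R]_m -> R) (rho : R).
Hypothesis S_cc : convex_concave S.
Hypothesis S_C1 : continuously_differentiable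
  (fun z : 'rV[R]_n * 'rV[R]_m => S z.1 z.2).
Hypothesis rho_gt0 : 0 < rho.
Context (x xh : R -> 'rV[R]_n) (y yh : R -> 'rV[R]_m).
Hypothesis flow : augmented_saddle_flow S rho x xh y yh.

Let z (t : R) : state R n m := ((x t, xh t), (y t, yh t)).

Lemma is_derive_trajectory (t : R) : 0 < t ->
  [/\ is_derive t 1 x (velocity_x S rho (z t)),
      is_derive t 1 xh (velocity_xh rho (z t)),
      is_derive t 1 y (velocity_y S rho (z t)) &
      is_derive t 1 yh (velocity_yh rho (z t))].
Proof. exact: flow.2. Qed.

Lemma is_derive_lyapunov a b (t : R) : 0 < t ->
  is_derive t 1 (fun s => lyapunov a b (z s)) (lyapunov_rate S rho a b (z t)).
Proof.
move=> /is_derive_trajectory[dx dxh dy dyh].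
have ? := is_derive_sqnorm2 a dx; have ? := is_derive_sqnorm2 a dxh.
have ? := is_derive_sqnorm2 b dy; have ? := is_derive_sqnorm2 b dyh.
by apply: is_deriveD; apply: is_deriveD.
Qed.

Lemma lyapunov_nonincreasing a b : saddle_point S a b ->
  forall s t : R, 0 < s -> s <= t -> lyapunov a b (z t) <= lyapunov a b (z s).
Proof.
move=> sab; apply: (nonincreasing_of_derive (is_derive_lyapunov a b)) => t t0.
apply: le_trans (lyapunov_dissipation rho S_cc S_C1 (z t) sab) _.
by rewrite mulNr oppr_le0 mulr_ge0 ?addr_ge0 ?sqnorm2_ge0 ?mulr_ge0// ltW.
Qed.

(** Every squared coordinate difference is at most the sum of squares. This gives the bounding box
    of the trajectory, and later convergence, with [r] arbitrarily small. *)
Lemma lyapunov_coord a b (q : state R n m) (r : R) :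
  0 <= r -> lyapunov a b q <= r ^+ 2 ->
  [/\ forall i, `|q.1.1 ord0 i - a ord0 i| <= r,
      forall i, `|q.1.2 ord0 i - a ord0 i| <= r,
      forall i, `|q.2.1 ord0 i - b ord0 i| <= r &
      forall i, `|q.2.2 ord0 i - b ord0 i| <= r].
Proof.
move=> r0 Vr.
have coord k (u c : 'rV[R]_k) i : sqnorm2 (u - c) <= r ^+ 2 ->
    `|u ord0 i - c ord0 i| <= r.
  move=> ucr; rewrite -(@ler_pXn2r _ 2)// ?nnegrE// real_normK ?num_real//.
  by apply: le_trans ucr; have := sqnorm2_coord (u - c) i; rewrite !mxE.
have := sqnorm2_ge0 (q.1.1 - a); have := sqnorm2_ge0 (q.1.2 - a).
have := sqnorm2_ge0 (q.2.1 - b); have := sqnorm2_ge0 (q.2.2 - b).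
by rewrite /lyapunov in Vr => *; split => i; apply: coord; lra.
Qed.

Lemma trajectory_compact a b : saddle_point S a b ->
  exists2 K, compact K & forall t, 1 <= t -> K (z t).
Proof.
(* Adding 1 makes [r ^+ 2] exceed the nonnegative initial value without a square root. Time 1 is an
   arbitrary positive start, since the equation is given only for positive times. *)
move=> sab; pose r := lyapunov a b (z 1) + 1.
have V1 := lyapunov_ge0 a b (z 1).
pose B k (c : 'rV[R]_k) :=
  [set u : 'rV[R]_k | forall i, `|u ord0 i - c ord0 i| <= r].
exists ((B n a `*` B n a) `*` (B m b `*` B m b)) => [|t t1].
  by do !apply: compact_setX; exact: compact_box.
have [||] // := @lyapunov_coord a b (z t) r; first by rewrite /r addr_ge0.
apply: le_trans (lyapunov_nonincreasing sab ltr01 t1) _.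
by rewrite /r; nra.
Qed.

Lemma trajectory_lipschitz a b : saddle_point S a b ->
  exists L, forall s t : R, 1 <= s -> s <= t -> `|z t - z s| <= L * (t - s).
Proof.
move=> /trajectory_compact[K cK zK].
have D t t0 := @is_derive_trajectory t t0.
have [Lx Lx0 Lxp] := lipschitz_trajectory cK zK
  (@continuous_velocity_x R n m S rho S_C1)
  (fun t t0 => let: And4 d _ _ _ := D t t0 in d).
have [Lh Lh0 Lhp] := lipschitz_trajectory cK zK
  (@continuous_velocity_xh R n m rho)
  (fun t t0 => let: And4 _ d _ _ := D t t0 in d).
have [Ly Ly0 Lyp] := lipschitz_trajectory cK zK
  (@continuous_velocity_y R n m S rho S_C1)
  (fun t t0 => let: And4 _ _ d _ := D t t0 in d).
have [Lk Lk0 Lkp] := lipschitz_trajectory cK zK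
  (@continuous_velocity_yh R n m rho)
  (fun t t0 => let: And4 _ _ _ d := D t t0 in d).
(* The norm on the product is the maximum of the four norms, so any common upper bound of the four
   constants works. *)
exists (Lx + Lh + Ly + Lk) => s t s1 st.
have ts : 0 <= t - s by rewrite subr_ge0.
rewrite !prod_normE/= !ge_max -!andbA; apply/and4P; split.
- by apply: le_trans (Lxp _ _ s1 st) _; rewrite ler_wpM2r//; lra.
- by apply: le_trans (Lhp _ _ s1 st) _; rewrite ler_wpM2r//; lra.
- by apply: le_trans (Lyp _ _ s1 st) _; rewrite ler_wpM2r//; lra.
- by apply: le_trans (Lkp _ _ s1 st) _; rewrite ler_wpM2r//; lra.
Qed.

Lemma cluster_consensus a b p : saddle_point S a b ->
  cluster (z @ +oo) p -> p.1.1 = p.1.2 /\ p.2.1 = p.2.2.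
Proof.
move=> sab clp; have [L zL] := trajectory_lipschitz sab.
have rate0 : lyapunov_rate S rho a b p = 0.
  apply: (cluster_rate_eq0 zL (is_derive_lyapunov a b)) clp.
    apply: nonincreasing_cauchy; first exact: lyapunov_nonincreasing.
    by move=> t; exact: lyapunov_ge0.
  exact: continuous_lyapunov_rate.
(* With zero rate, the dissipation bound forces the sum of the two squared norms to be at most 0. *)
have := lyapunov_dissipation rho S_cc S_C1 p sab; rewrite rate0 mulNr oppr_ge0.
rewrite pmulr_rle0 ?mulr_gt0// => w0.
have := sqnorm2_ge0 (p.1.1 - p.1.2); have := sqnorm2_ge0 (p.2.1 - p.2.2).
by move=> *; split; apply/subr0_eq/sqnorm2_eq0; lra.
Qed.

Lemma cluster_gradient0 a b p : saddle_point S a b ->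
  cluster (z @ +oo) p ->
  gradient (fun u => S u p.2.1) p.1.1 = 0 /\
  gradient (fun v => S p.1.1 v) p.2.1 = 0.
Proof.
move=> sab clp; have [L zL] := trajectory_lipschitz sab.
have [px py] := cluster_consensus sab clp.
have [K cK zK] := trajectory_compact sab.
have zKoo : \forall t \near +oo, K (z t).
  by near=> t; apply: zK; near: t; apply: nbhs_pinfty_ge; rewrite num_real.
split; apply/rowP => i; rewrite [RHS]mxE.
- pose h (q : state R n m) := q.1.1 ord0 i - q.1.2 ord0 i.
  have hc : continuous h.
    have c1 := @continuous_coord R _ _ _ i (@continuous_11 R n m).
    have c2 := @continuous_coord R _ _ _ i (@continuous_12 R n m).
    by move=> q; exact: cvgB (c1 q) (c2 q).
  have h0 : h (z t) @[t --> +oo] --> 0.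
    apply: cvg_of_cluster cK zKoo hc _ => q /(cluster_consensus sab)[e _].
    by rewrite /h e subrr.
  (* This is the rate of [h]. Where [x = xh] all the coupling terms vanish, and only minus the
     [i]-th partial derivative remains. *)
  pose g q := velocity_x S rho q ord0 i - velocity_xh rho q ord0 i.
  have dh (t : R) : 0 < t -> is_derive t 1 (fun s => h (z s)) (g (z t)).
    move=> /is_derive_trajectory[dx dxh _ _].
    by apply: is_deriveB; exact: is_derive_coord.
  have : g p = 0.
    apply: (cluster_rate_eq0 zL dh (cauchy_of_cvg h0) _ clp).
    apply: cvgB; first exact: (@continuous_velocity_x R n m S rho S_C1).
    exact: continuous_velocity_xh.
  rewrite /g !mxE px subrr mulr0 !subr0 => /eqP.
  by rewrite oppr_eq0 => /eqP.
- pose h (q : state R n m) := q.2.1 ord0 i - q.2.2 ord0 i.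
  have hc : continuous h.
    have c1 := @continuous_coord R _ _ _ i (@continuous_21 R n m).
    have c2 := @continuous_coord R _ _ _ i (@continuous_22 R n m).
    by move=> q; exact: cvgB (c1 q) (c2 q).
  have h0 : h (z t) @[t --> +oo] --> 0.
    apply: cvg_of_cluster cK zKoo hc _ => q /(cluster_consensus sab)[_ e].
    by rewrite /h e subrr.
  pose g q := velocity_y S rho q ord0 i - velocity_yh rho q ord0 i.
  have dh (t : R) : 0 < t -> is_derive t 1 (fun s => h (z s)) (g (z t)).
    move=> /is_derive_trajectory[_ _ dy dyh].
    by apply: is_deriveB; exact: is_derive_coord.
  have : g p = 0.
    apply: (cluster_rate_eq0 zL dh (cauchy_of_cvg h0) _ clp).
    apply: cvgB; first exact: (@continuous_velocity_y R n m S rho S_C1).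
    exact: continuous_velocity_yh.
  by rewrite /g !mxE py subrr mulr0 !subr0.
Unshelve. all: by end_near. Qed.

(** The Lyapunov function centred at the cluster point is 0 there, so by continuity it is small at
    some time, and by monotonicity at all later ones. *)
Lemma trajectory_cvg a b : saddle_point S a b ->
  cluster (z @ +oo) ((a, a), (b, b)) ->
  [/\ x t @[t --> +oo] --> a, xh t @[t --> +oo] --> a,
      y t @[t --> +oo] --> b & yh t @[t --> +oo] --> b].
Proof.
move=> sab clp.
have close (e : R) : 0 < e -> \forall t \near +oo, lyapunov a b (z t) <= e ^+ 2.
  move=> e0.
  have [_ [[s s1 <-] Vs]] :
      exists q, (z @` [set s | 1 <= s]) q /\ lyapunov a b q < e ^+ 2.
    apply: clp.
      have : \forall s \near +oo, (1 : R) <= s.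
        by apply: nbhs_pinfty_ge; rewrite num_real.
      by apply: filterS => s s1; exists s.
    have V0 : lyapunov a b ((a, a), (b, b)) = 0.
      by rewrite /lyapunov/= !subrr !sqnorm2_0 !addr0.
    have := @continuous_lyapunov R n m a b ((a, a), (b, b)).
    by rewrite /continuous_at V0 => /cvgr_lt; apply; rewrite exprn_gt0.
  have : \forall t \near +oo, s <= t by apply: nbhs_pinfty_ge; rewrite num_real.
  apply: filterS => t st; apply: le_trans (ltW Vs).
  by apply: (lyapunov_nonincreasing sab) st; exact: lt_le_trans s1.
(* A value at most [e ^+ 2] keeps each coordinate within [e] of its limit, hence also each vector in
   the sup norm. *)
by split; apply/cvgrPdist_le => e e0; have := close _ e0;
  apply: filterS => t /(lyapunov_coord (ltW e0))[? ? ? ?];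
  rewrite distrC; apply: rV_norm_le (ltW e0) _ => i; rewrite !mxE.
Qed.
End trajectory.

(** The quadratic terms vanish on equal pairs. Moving [(u, uh)] can only add a nonnegative term, and
    moving [(v, vh)] only a nonpositive one. *)
Lemma saddle_point_augmented (R : realType) (n m : nat)
    (S : 'rV[R]_n -> 'rV[R]_m -> R) (rho : R) a b :
  0 < rho -> saddle_point S a b ->
  saddle_point (augmented S rho) (a, a) (b, b).
Proof.
move=> rho0 sab [u uh] [v vh]; rewrite /augmented/= !subrr.
rewrite !sqnorm2_0 !mulr0 !subr0 !add0r.
have [? ?] := sab u v.
have ge0 k (w : 'rV[R]_k) : 0 <= rho / 2 * sqnorm2 w.
  by rewrite mulr_ge0 ?sqnorm2_ge0// divr_ge0// ltW.
by have := ge0 _ (u - uh); have := ge0 _ (v - vh); split; lra.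
Qed.

Theorem corollary9 (R : realType) (n m : nat)
    (S : 'rV[R]_n -> 'rV[R]_m -> R) (rho : R)
    (S_cc : convex_concave S)
    (S_C1 : continuously_differentiable
              (fun z : 'rV[R]_n * 'rV[R]_m => S z.1 z.2))
    (S_saddle : exists xs ys, saddle_point S xs ys)
    (rho_gt0 : 0 < rho)
    (x xh : R -> 'rV[R]_n) (y yh : R -> 'rV[R]_m)
    (flow : augmented_saddle_flow S rho x xh y yh) :
  exists (xs xhs : 'rV[R]_n) (ys yhs : 'rV[R]_m),
    [/\ x t @[t --> +oo] --> xs, xh t @[t --> +oo] --> xhs,
        y t @[t --> +oo] --> ys & yh t @[t --> +oo] --> yhs] /\
    saddle_point (augmented S rho) (xs, xhs) (ys, yhs) /\
    saddle_point S xs ys.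
Proof.
have [a [b sab]] := S_saddle.
have [K cK zK] := trajectory_compact S_cc S_C1 rho_gt0 flow sab.
have zKoo : \forall t \near +oo, K ((x t, xh t), (y t, yh t)).
  by near=> t; apply: zK; near: t; apply: nbhs_pinfty_ge; rewrite num_real.
have [[[xs xhs] [ys yhs]] [_ clp]] :=
  cK ((fun t => ((x t, xh t), (y t, yh t))) @ +oo) _ zKoo.
have [/= ex ey] := cluster_consensus S_cc S_C1 rho_gt0 flow sab clp.
rewrite -{}ex -{}ey {xhs yhs} in clp.
have [/= gx gy] := cluster_gradient0 S_cc S_C1 rho_gt0 flow sab clp.
(* Unlike the given saddle point [(a, b)], this one comes from a cluster point of the trajectory, so
   it can serve as the centre of the Lyapunov function. *)
have sp := saddle_point_of_gradient0 S_cc S_C1 gx gy.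
exists xs, xs, ys, ys; split.
  exact: (trajectory_cvg S_cc S_C1 rho_gt0 flow sp clp).
by split => //; exact: saddle_point_augmented.
Unshelve. all: by end_near. Qed.
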